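(* Let $K$ be a field, $n\ge 1$, $S=K[x_1,\ldots,x_n]$, and let $I$ be a squarefree monomial ideal of $S$ with $0\neq I\neq S$. If $\operatorname{hdepth}(S/I)\leq 8$, then $$\operatorname{hdepth}(I)\geq \operatorname{hdepth}(S/I)-1.$$
   Context: The ring $S=K[x_1,\ldots,x_n]$ has the standard grading. For a nonzero finitely generated graded $S$-module $M$, the Hilbert depth $\operatorname{hdepth}(M)$ is the maximal depth of a finitely generated graded $S$-module $N$ with the same Hilbert series as $M$. For squarefree monomial ideals $0\subset I\subsetneq J\subset S$, it is computed by the following known formula, which may be taken as the definition. For $0\le j\le n$ let $\alpha_j(J/I)$ be the number of squarefree monomials $u$ of degree $j$ with $u\in J\setminus I$. For $0\le k\le q\le n$ put $$\beta_k^q(J/I):=\sum_{j=0}^k (-1)^{k-j}\binom{q-j}{k-j}\alpha_j(J/I).$$ Then $\operatorname{hdepth}(J/I)=\max\{q\in\{0,\ldots,n\} : \beta_k^q(J/I)\ge 0 \text{ for all } 0\le k\le q\}$. This applies to $S/I$ (pair $I\subsetneq S$) and to $I$ (pair $0\subsetneq I$). *)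

(* Defs.v *)
From HB Require Import structures.
From mathcomp Require Import all_boot all_order all_algebra.
From mathcomp Require Import mpoly.

Set Implicit Arguments.
Unset Strict Implicit.
Unset Printing Implicit Defensive.

Import Order.TTheory GRing.Theory Num.Theory.
Local Open Scope ring_scope.

Definition squarefree_mon (n : nat) (m : 'X_{1..n}) : bool :=
  [forall i : 'I_n, (m i <= 1)%N].

Definition in_ideal_generated (K : fieldType) (n : nat) (G : seq 'X_{1..n})
    (p : {mpoly K[n]}) : Prop :=
  exists c : 'X_{1..n} -> {mpoly K[n]}, p = \sum_(m <- G) c m * 'X_[m].

(* A finite list of generators loses nothing: there are only finitely many
   squarefree monomials in n variables. *)
Definition squarefree_monomial_ideal (K : fieldType) (n : nat)
    (I : {pred {mpoly K[n]}}) : Prop :=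
  exists2 G : seq 'X_{1..n}, all (@squarefree_mon n) G
    & forall p : {mpoly K[n]}, p \in I <-> in_ideal_generated G p.

Definition zero_ideal (K : fieldType) (n : nat) : {pred {mpoly K[n]}} :=
  pred1 0.

Definition unit_ideal (K : fieldType) (n : nat) : {pred {mpoly K[n]}} :=
  predT.

Arguments zero_ideal : clear implicits.
Arguments unit_ideal : clear implicits.

Section HilbertDepth.
Variables (K : fieldType) (n : nat).

(* The quotient J / I is represented by the pair J, I with I contained in J;
   I itself is the pair I, 0 and S / I is the pair S, I. *)
Implicit Types J I : {pred {mpoly K[n]}}.

(* 'X_{1..n < j.+1} is the finite type of exponent vectors of degree <= j. *)
Definition alpha J I (j : nat) : nat :=
  #|[set m : 'X_{1..n < j.+1} | [&& squarefree_mon m, mdeg m == j,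
       ('X_[m] : {mpoly K[n]}) \in J & ('X_[m] : {mpoly K[n]}) \notin I]]|.

Definition beta J I (q k : nat) : int :=
  \sum_(j < k.+1) (-1) ^+ (k - j) * ('C(q - j, k - j))%:Z * (alpha J I j)%:Z.

(* q = 0 is always admissible, since beta J I 0 0 = alpha J I 0, so the
   value 0 of an empty maximum never occurs. *)
Definition hdepth J I : nat :=
  \max_(q < n.+1 | [forall k : 'I_q.+1, 0 <= beta J I q k]) q.

End HilbertDepth.

(* Main.v *)
(* Let Delta be the simplicial complex of the squarefree monomials outside I,
   a_j its number of faces with j vertices and d_j = 'C(n, j) - a_j, so that
   the beta's of I are those of d. We must bound beta^(q-1)_k(d) from below,
   given beta^q_k(a) >= 0 for k <= q <= 8. Coning Delta raises n and q by one
   and preserves all the beta's, and removing the vertices that are not faces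
   only strengthens the claim: hence q = 8, d_0 = d_1 = 0, and with N = n - 8
   the claim reads d_3 >= 5 d_2, d_4 >= 4 d_3 - 10 d_2, ...,
   d_7 >= d_6 - d_5 + d_4 - d_3 + d_2.
   For N >= 11 the local LYM inequality (k+1) d_(k+1) >= (n-k) d_k suffices.
   For N <= 10 one eliminates all d_j but d_k and d_(k+1) with the help of
   beta^8 >= 0, and the resulting inequalities between d_k and d_(k+1) follow
   from the Kruskal-Katona theorem by a finite computation; there are two
   exceptional values, N = 3, d_3 = 45 and N = 4, d_4 = 44 or 45, settled by
   integrality and by beta^8_6 >= 0. *)

Require Import Defs.
From Stdlib Require Import ZArith.
From HB Require Import structures.
From mathcomp Require Import all_boot all_order all_algebra.
From mathcomp Require Import zify ring.
From mathcomp Require Import mpoly.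

Set Implicit Arguments.
Unset Strict Implicit.
Unset Printing Implicit Defensive.

(** * The Kruskal-Katona function *)

(* kk n k m is the largest number of faces with k+1 vertices in a simplicial
   complex on n vertices having m faces with k vertices, m <= 'C(n, k). The
   extremal complex takes the m first k-sets in colexicographic order: those
   avoiding the last vertex come first. *)
Fixpoint kk (n k m : nat) : nat :=
  if n is n'.+1 then
    if k is k'.+1 then
      if m <= 'C(n', k) then kk n' k m
      else 'C(n', k.+1) + kk n' k' (m - 'C(n', k))
    else if m == 0 then 0 else n
  else 0.

Lemma kkn0 n m : kk n 0 m = if m == 0 then 0 else n.
Proof. by case: n => //=; case: eqP. Qed.

Lemma kk_bound n k m : kk n k m <= 'C(n, k.+1).
Proof.
elim: n k m => [|n IHn] [|k] m //=; first by rewrite bin1; case: eqP.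
rewrite (binS n k.+1); case: (leqP m) => _; last by rewrite leq_add2l.
exact: leq_trans (IHn _ _) (leq_addr _ _).
Qed.

Lemma kk0 n k : kk n k 0 = 0.
Proof. by elim: n k => [|n IHn] [|k] //=; rewrite leq0n. Qed.

Lemma kk_full n k : kk n k 'C(n, k) = 'C(n, k.+1).
Proof.
elim: n k => [|n IHn] [|k] //=; first by rewrite bin1.
rewrite !binS; case: (leqP (_ + _)) => le.
  have n0 : 'C(n, k) = 0 by lia.
  have lt_nk : n < k by move/eqP: n0; rewrite -leqn0 leqNgt bin_gt0 -ltnNge.
  by rewrite n0 addn0 IHn (@bin_small n k.+1) ?addn0 // ltnW.
by rewrite addKn IHn.
Qed.

Lemma kk_lo n k m : m <= 'C(n, k.+1) -> kk n.+1 k.+1 m = kk n k.+1 m.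
Proof. by move=> /= ->. Qed.

(** At [m = 'C(n, k.+1)] both branches of [kk] agree by [kk_full], so the boundary value may be put
    on either side. *)
Lemma kk_hi n k m : 'C(n, k.+1) <= m ->
  kk n.+1 k.+1 m = 'C(n, k.+2) + kk n k (m - 'C(n, k.+1)).
Proof.
rewrite leq_eqVlt => /orP[/eqP <- /=|lt /=]; last by rewrite leqNgt lt.
by rewrite leqnn subnn kk0 kk_full addn0.
Qed.

Lemma kk_mono n k a b : a <= b -> kk n k a <= kk n k b.
Proof.
elim: n k a b => [|n IHn] [|k] a b ab //=.
  by case: a ab => // a; case: b.
case: (leqP a) => ha; case: (leqP b) => hb; last 1 first.
- by rewrite leq_add2l IHn // leq_sub2r.
- exact: IHn.
- by rewrite (leq_trans (kk_bound _ _ _)) ?leq_addr.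
- by have := leq_trans ha (leq_trans ab hb); rewrite ltnn.
Qed.

(** The extremal complex contains every edge between its [m] vertices. *)
Lemma kkn1 n m : m <= n -> kk n 1 m = 'C(m, 2).
Proof.
elim: n m => [|n IHn] m /=; first by rewrite leqn0 => /eqP ->.
rewrite bin1; case: (leqP m n) => [/IHn //|lt le].
have -> : m = n.+1 by apply/eqP; rewrite eqn_leq le lt.
by rewrite subSnn kkn0 /= binS bin1.
Qed.

(** A descent at [k] means [n - k < k.+1], and this persists for larger [k]. Below it helps to keep
    the arguments of [kk_level] and [kk_colevel] in range. *)
Lemma bin_no_valley n k :
  'C(n, k.+1) < 'C(n, k) -> 'C(n, k.+2) <= 'C(n, k.+1).
Proof.
have [lt_nk|le_kn] := ltnP n k; first by rewrite !bin_small //; lia.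
have := mul_bin_left n k; have := mul_bin_left n k.+1 => h1 h2 lt.
have h3 : n - k < k.+1 by rewrite ltnNge; apply/negP => h; nia.
nia.
Qed.

(* The next four properties are proved together by induction on n: splitting
   off the last vertex turns each of them at level k+1 into instances of all
   of them at levels k, k+1, k+2. *)
Definition kk_superadditive n k := forall a b, a + b <= 'C(n, k) ->
  kk n k a + kk n k b <= kk n k (a + b).
Definition kk_corner n k := forall a b, a <= 'C(n, k) -> b <= 'C(n, k) ->
  'C(n, k) <= a + b ->
  kk n k a + kk n k b <= 'C(n, k.+1) + kk n k (a + b - 'C(n, k)).
Definition kk_level n k := forall y, y <= 'C(n, k) -> y <= 'C(n, k.+1) ->
  kk n k.+1 y <= kk n k y.
Definition kk_colevel n k := forall x, x <= 'C(n, k) -> x <= 'C(n, k.+1) ->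
  'C(n, k.+2) + kk n k ('C(n, k) - x)
    <= 'C(n, k.+1) + kk n k.+1 ('C(n, k.+1) - x).

Lemma kk_superadditive_step n k :
  kk_superadditive n k -> kk_superadditive n k.+1 -> kk_corner n k.+1 ->
  kk_level n k -> kk_superadditive n.+1 k.+1.
Proof.
move=> S1 S2 T2 P a b; rewrite binS.
wlog le_ab : a b / a <= b => [hw|].
  by case: (leqP a b) => [|/ltnW] h le; [|rewrite addnC [a + b]addnC]; apply: hw => //; lia.
move=> le.
have fullA := kk_full n k; have fullB := kk_full n k.+1.
case: (leqP (a + b) 'C(n, k.+1)) => hab.
  by rewrite !kk_lo ?S2 //; lia.
rewrite [kk n.+1 _ (a + b)]kk_hi; last exact: ltnW.
case: (leqP b 'C(n, k.+1)) => hb.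
  rewrite !kk_lo; [|lia..].
  have := T2 a b; have := P (a + b - 'C(n, k.+1)); lia.
rewrite [kk _ _ b]kk_hi; last exact: ltnW.
case: (leqP a 'C(n, k.+1)) => ha.
  rewrite kk_lo //.
  have := P a; have := S1 a (b - 'C(n, k.+1)).
  have -> : a + b - 'C(n, k.+1) = a + (b - 'C(n, k.+1)) by lia.
  lia.
rewrite kk_hi; last exact: ltnW.
(* Here ['C(n, k.+1) < 'C(n, k)]. One of the two summands ['C(n, k.+2)] is [kk n k.+1 'C(n, k.+1)];
   [kk_level] moves it to level [k], where superadditivity absorbs it. *)
have := P 'C(n, k.+1); have := S1 (a - 'C(n, k.+1)) (b - 'C(n, k.+1)).
have := S1 (a - 'C(n, k.+1) + (b - 'C(n, k.+1))) 'C(n, k.+1).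
have -> : a - 'C(n, k.+1) + (b - 'C(n, k.+1)) + 'C(n, k.+1) = a + b - 'C(n, k.+1)
  by lia.
lia.
Qed.

Lemma kk_corner_step n k :
  kk_superadditive n k -> kk_corner n k -> kk_corner n k.+1 ->
  kk_colevel n k -> kk_corner n.+1 k.+1.
Proof.
move=> S1 T1 T2 R a b; rewrite !binS.
wlog le_ab : a b / a <= b => [hw|].
  by case: (leqP a b) => [|/ltnW] h la lb le;
     [|rewrite addnC [a + b]addnC]; apply: hw => //; lia.
set A := 'C(n, k); set B := 'C(n, k.+1); set D := 'C(n, k.+2) => la lb le.
set z := a + b - (B + A).
have fullA := kk_full n k; have fullB := kk_full n k.+1.
rewrite -/A -/B -/D in fullA fullB.
case: (leqP b B) => hb.
  rewrite !kk_lo; [|rewrite -/B; lia..].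
  (* [R A] reads [D <= B + kk n k.+1 (B - A)]; with the second corner inequality it bounds
     [kk n k.+1 (A + z)] by [B + kk n k.+1 z]. *)
  have := T2 a b; have := T2 (A + z) (B - A); have := R A.
  rewrite -/A -/B -/D subnn kk0.
  have -> : a + b - B = A + z by lia.
  have -> : A + z + (B - A) - B = z by lia.
  lia.
rewrite [kk _ _ b]kk_hi -/B -/D; last exact: ltnW.
case: (leqP a B) => ha.
  rewrite !kk_lo -/B; [|lia..].
  have := R (a - z); have := T2 a (B - (a - z)); rewrite -/A -/B -/D.
  have -> : a + (B - (a - z)) - B = z by lia.
  have -> : A - (a - z) = b - B by lia.
  lia.
rewrite [kk _ _ a]kk_hi -/B -/D; last exact: ltnW.
case: (leqP A (a - B + (b - B))) => hs.
  rewrite [kk _ _ z]kk_hi -/B -/D; last lia.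
  have := T1 (a - B) (b - B); rewrite -/A -/B.
  have -> : a - B + (b - B) - A = z - B by lia.
  lia.
rewrite [kk _ _ z]kk_lo -/B; last lia.
have := S1 (a - B) (b - B); have := R (B - z); rewrite -/A -/B -/D.
have -> : A - (B - z) = a - B + (b - B) by lia.
have -> : B - (B - z) = z by lia.
lia.
Qed.

Lemma kk_level_step n k :
  kk_superadditive n k.+1 -> kk_corner n k.+1 -> kk_corner n k.+2 ->
  kk_level n k -> kk_level n k.+1 -> kk_colevel n k.+1 -> kk_level n.+1 k.+1.
Proof.
move=> S1 T1 T2 P0 P1 R1 y; rewrite !binS.
have := @bin_no_valley n k.
have := kk_full n k.+1; have := kk_full n k.+2.
set A0 := 'C(n, k); set A := 'C(n, k.+1); set B := 'C(n, k.+2).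
set D := 'C(n, k.+3) => fB fA valley y1 y2.
case: (leqP y A) => yA; case: (leqP y B) => yB.
- by rewrite !kk_lo -/A -/B //; apply: P1.
- rewrite [kk n.+1 k.+1 _]kk_lo -/A // kk_hi -/B -/D; last exact: ltnW.
  have := S1 B (y - B); have := P1 B; rewrite -/A -/B subnKC; last lia.
  lia.
- rewrite [kk n.+1 k.+1 _]kk_hi -/A -/B; last exact: ltnW.
  rewrite kk_lo -/B //.
  have := T2 y (B - A); have := R1 A; have := P1 (y - A); have := P0 (y - A).
  rewrite -/A0 -/A -/B -/D subnn kk0.
  have -> : y + (B - A) - B = y - A by lia.
  lia.
- rewrite !kk_hi -/A -/B -/D; [|exact: ltnW..].
  (* To pass from [y - B] to [y - A], superadditivity adds [B - A] if [A <= B]; otherwise the corner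
     inequality adds [B] and removes [A]. *)
  case: (leqP A B) => AB.
    have := S1 (y - B) (B - A); have := R1 A; have := P1 (B - A); have := P0 (y - A).
    rewrite -/A0 -/A -/B -/D subnn kk0.
    have -> : y - B + (B - A) = y - A by lia.
    lia.
  have := T1 (y - B) B; have := P1 B; have := P0 (y - A).
  rewrite -/A0 -/A -/B -/D.
  have -> : y - B + B - A = y - A by lia.
  lia.
Qed.

Lemma kk_colevel_step n k :
  kk_superadditive n k -> kk_superadditive n k.+1 -> kk_corner n k.+1 ->
  kk_level n k -> kk_colevel n k -> kk_colevel n k.+1 -> kk_colevel n.+1 k.+1.
Proof.
move=> S0 S1 T1 P0 R0 R1 x; rewrite !binS.
have := @bin_no_valley n k.
have := kk_full n k.+1; have := kk_full n k.
set A0 := 'C(n, k); set A := 'C(n, k.+1); set B := 'C(n, k.+2).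
set D := 'C(n, k.+3) => fA0 fA valley x1 x2.
case: (leqP x A) => xA; case: (leqP x A0) => xA0.
- rewrite !kk_hi -/A -/B -/D; [|lia..].
  have := R0 x; rewrite -/A0 -/A -/B.
  have -> : A + A0 - x - A = A0 - x by lia.
  have -> : B + A - x - B = A - x by lia.
  lia.
- rewrite [kk n.+1 k.+1 _]kk_lo -/A; last lia.
  rewrite kk_hi -/B -/D; last lia.
  have := T1 (A + A0 - x) (A - A0); have := R0 A0.
  rewrite -/A0 -/A -/B subnn kk0.
  have -> : A + A0 - x + (A - A0) - A = A - x by lia.
  have -> : B + A - x - B = A - x by lia.
  lia.
- rewrite [kk n.+1 k.+1 _]kk_hi -/A -/B; last lia.
  rewrite kk_lo -/B; last lia.
  have := R1 (x - A); have := R0 (x - A); have := S0 (A0 - x) A; have := P0 A.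
  rewrite -/A0 -/A -/B -/D.
  have -> : A0 - x + A = A0 - (x - A) by lia.
  have -> : A + A0 - x - A = A0 - x by lia.
  have -> : B + A - x = B - (x - A) by lia.
  lia.
- rewrite !kk_lo -/A -/B; [|lia..].
  have := R1 (x - A); rewrite -/A -/B -/D.
  have -> : B + A - x = B - (x - A) by lia.
  case: (leqP A0 A) => AA.
    have := S1 (A + A0 - x) (A - A0); have := R0 A0.
    rewrite -/A0 -/A -/B subnn kk0.
    have -> : A + A0 - x + (A - A0) = A - (x - A) by lia.
    lia.
  have := T1 (A + A0 - x) (A - (A0 - A)); have := R0 (A0 - A); have := P0 A.
  rewrite -/A0 -/A -/B.
  have -> : A + A0 - x + (A - (A0 - A)) - A = A - (x - A) by lia.
  have -> : A0 - (A0 - A) = A by lia.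
  lia.
Qed.

Lemma kk_quad n k : [/\ kk_superadditive n k, kk_corner n k, kk_level n k
  & kk_colevel n k].
Proof.
have S0 n' : kk_superadditive n' 0.
  by move=> a b; rewrite bin0 !kkn0; case: a b => [|[|a]] [|[|b]] //=; lia.
have T0 n' : kk_corner n' 0.
  by move=> a b; rewrite bin0 bin1 !kkn0; case: a b => [|[|a]] [|[|b]] //=; lia.
have P0 n' : kk_level n' 0.
  move=> [|[|y]]; rewrite ?kk0 // bin0 // bin1 => _ n'_gt0.
  by rewrite kkn1.
have R0 n' : kk_colevel n' 0.
  move=> [|[|x]]; rewrite ?bin0 ?bin1 ?subn0 //= => _.
    by rewrite kkn0 kkn1 //= addnC.
  case: n' => // n' _; rewrite subnn kk0 subn1 kkn1 //= binS bin1; lia.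
elim: n k => [|n IHn] [|k]; split=> //.
- by have [? _ ? _] := IHn k; have [? ? _ _] := IHn k.+1; apply: kk_superadditive_step.
- by have [? ? _ ?] := IHn k; have [_ ? _ _] := IHn k.+1; apply: kk_corner_step.
- have [_ _ ? _] := IHn k; have [? ? ? ?] := IHn k.+1; have [_ ? _ _] := IHn k.+2.
  exact: kk_level_step.
- have [? _ ? ?] := IHn k; have [? ? _ ?] := IHn k.+1.
  exact: kk_colevel_step.
Qed.

(* The numerical content of the Kruskal-Katona theorem: a and b count the faces
   avoiding, respectively containing, a given vertex. *)
Lemma kk_merge n k a b : a <= 'C(n, k.+1) -> b <= 'C(n, k) ->
  kk n k.+1 a + minn a (kk n k b) <= kk n.+1 k.+1 (a + b).
Proof.
elim: n k a b => [|n IHn] k a b.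
  by rewrite bin0n leqn0 => /eqP ->; rewrite min0n.
case: k => [|k].
  rewrite bin0 bin1 kkn0; case: b => [|[|//]] an _.
    by rewrite minn0 !addn0 [kk n.+2 1 a]kk_lo ?bin1.
  rewrite !kkn1 ?addn1 // binS bin1 leq_add2l; exact: geq_minl.
have [S T _ _] := kk_quad n k.+1.
have fA := kk_full n k.+1; have fB := kk_full n k.+2.
rewrite !binS; move: S T fA fB; rewrite /kk_superadditive /kk_corner.
set A2 := 'C(n, k); set A := 'C(n, k.+1); set B := 'C(n, k.+2).
set D := 'C(n, k.+3) => S T fA fB ha hb.
have CB : 'C(n.+1, k.+2) = B + A by rewrite binS.
have CD : 'C(n.+1, k.+3) = D + B by rewrite binS.
have CA : 'C(n.+1, k.+1) = A + A2 by rewrite binS.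
case: (leqP a B) => aB; case: (leqP b A) => bA.
- rewrite kk_lo ?[kk n.+1 k.+1 b]kk_lo // [kk n.+2 _ _]kk_lo ?CB ?leq_add //.
  exact: IHn.
(* Since [a <= B], already [b = A] brings the minimum up to [a]; the excess of [b] over [A] is
   dropped by monotonicity. *)
- have h : a + A <= a + b by rewrite leq_add2l ltnW.
  apply: leq_trans (kk_mono _ _ h).
  rewrite [kk n.+2 _ _]kk_lo ?CB ?leq_add2r // kk_lo //.
  have := IHn k.+1 a A aB (leqnn _); rewrite fA.
  by rewrite (minn_idPl aB) => h'; rewrite (leq_trans _ h') // leq_add2l geq_minl.
- rewrite [kk n.+1 k.+2 a]kk_hi -/B -/D; last exact: ltnW.
  rewrite [kk n.+1 k.+1 b]kk_lo //.
  have hb' : kk n k.+1 b <= B by rewrite kk_bound.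
  case: (leqP (a + b) (B + A)) => hs.
    rewrite [kk n.+2 _ _]kk_lo ?CB // kk_hi -/B -/D; last lia.
    have := S (a - B) b; have -> : a - B + b = a + b - B by lia.
    lia.
  rewrite [kk n.+2 _ _]kk_hi ?CB ?CD; last exact: ltnW.
  rewrite kk_lo -/A; last lia.
  have := T (a - B) b; have -> : a - B + b - A = a + b - (B + A) by lia.
  lia.
- rewrite [kk n.+1 k.+2 a]kk_hi -/B -/D; last exact: ltnW.
  rewrite [kk n.+1 k.+1 b]kk_hi -/A -/B; last exact: ltnW.
  rewrite [kk n.+2 _ _]kk_hi ?CB ?CD; last lia.
  have := IHn k (a - B) (b - A); rewrite -/A -/A2.
  have -> : a - B + (b - A) = a + b - (B + A) by lia.
  lia.
Qed.

(** The local LYM inequality, which for complexes counts incidences: a k-set lies in n - k sets of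
    size k + 1, and a face of that size contains k + 1 such k-sets. Here it is derived from the
    recursion of [kk]. *)
Lemma kk_lym n k m : m <= 'C(n, k) -> k.+1 * kk n k m <= (n - k) * m.
Proof.
elim: n k m => [|n IHn] [|k] m; rewrite ?muln0 //.
  by rewrite bin0 kkn0 subn0 mul1n; case: m => [|[|m]] //=; rewrite muln1.
case: (leqP m 'C(n, k.+1)) => hm.
  by rewrite kk_lo // => _; have := IHn _ _ hm; nia.
rewrite binS kk_hi; last exact: ltnW.
move=> hm'; have := IHn k (m - 'C(n, k.+1)); have := mul_bin_left n k.+1.
have := mul_bin_left n k; rewrite subSS; move: hm hm'.
set A := 'C(n, k); set B := 'C(n, k.+1); set D := 'C(n, k.+2).
move=> hm hm' hA hB; set y := m - B; set g := kk n k y => hg.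
have {}hg : k.+1 * g <= (n - k) * y by apply: hg; lia.
have hy : y <= A by lia.
have -> : m = B + y by lia.
have h2 : (n - k) * y <= k.+1 * B by rewrite hA leq_mul2l hy orbT.
(* The extra factor [k.+1] lets [h2] replace one copy of [(n - k) * y] by [k.+1 * B]; it is then
   cancelled. *)
have h3 : k.+1 * (k.+2 * g) <= k.+1 * ((n - k) * y + B) by nia.
have h4 : k.+2 * g <= (n - k) * y + B by move: h3; rewrite leq_mul2l.
case: (leqP k.+1 n) => kn; nia.
Qed.

(** * The Kruskal-Katona theorem *)

(** The value [a 0 = 0] is allowed because the link of a vertex that is not a face is void. *)
Definition kk_seq (n : nat) (a : nat -> nat) : Prop :=
  a 0 <= 1 /\ forall k, a k.+1 <= kk n k (a k).

Definition shift (b : nat -> nat) (j : nat) : nat := if j is i.+1 then b i else 0.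

Lemma kk_seq_bound n a : kk_seq n a -> forall k, a k <= 'C(n, k).
Proof.
by case=> a0 ha [|k]; rewrite ?bin0 // (leq_trans (ha k)) ?kk_bound.
Qed.

(** Here [a] stands for the deletion of a vertex and [b] for its link. The link lies in the
    deletion, whence [b j <= a j] and the minimum in [kk_merge]. *)
Lemma kk_seq_merge n a b : kk_seq n a -> kk_seq n b -> (forall j, b j <= a j) ->
  kk_seq n.+1 (fun j => a j + shift b j).
Proof.
move=> ha hb hba; have bda := kk_seq_bound ha; have bdb := kk_seq_bound hb.
split=> [|[|k]]; rewrite /shift; first by rewrite addn0; case: ha.
  case: ha => _ /(_ 0); rewrite addn0 !kkn0; case: eqP => [a0|_].
    by have := hba 0; rewrite a0 !leqn0 => /eqP -> /eqP ->.
  by have := bdb 0; rewrite bin0; lia.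
apply: leq_trans (kk_merge (bda _) (bdb _)).
case: ha hb => _ ha [_ hb]; apply: leq_add; first exact: ha.
by rewrite leq_min hba; apply: hb.
Qed.

Lemma kk_seq_shrink n m a : kk_seq n a -> a 1 <= m <= n -> kk_seq m a.
Proof.
elim: n => [|n IHn] ha /andP[a1m]; first by rewrite leqn0 => /eqP ->.
rewrite leq_eqVlt => /orP[/eqP -> //|]; rewrite ltnS => mn.
apply: IHn; last by rewrite a1m.
have a1n := leq_trans a1m mn; case: ha => a0 ha; split=> //.
have step k : a k.+1 <= 'C(n, k.+1) -> a k.+2 <= kk n k.+1 (a k.+1).
  by move=> h; rewrite -kk_lo.
elim=> [|k IHk]; last by apply/step/(leq_trans IHk)/kk_bound.
rewrite kkn0; have := ha 0; rewrite kkn0; case: eqP => //.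
Qed.

Definition face_number (T : finType) (D : pred {set T}) (V : {set T}) j :=
  #|[set A : {set T} | [&& A \subset V, #|A| == j & D A]]|.

Lemma face_number_setU1 (T : finType) (D : pred {set T}) (v : T) (V : {set T}) j :
  v \notin V ->
  face_number D (v |: V) j = face_number D V j +
    shift (face_number (fun A => D (v |: A)) V) j.
Proof.
move=> vV; rewrite /face_number.
set X := [set A | _].
have -> : #|X| = #|[set A in X | v \notin A]| + #|[set A in X | v \in A]|.
  rewrite -(cardsID [set A : {set T} | v \in A] X) addnC.
  by congr (_ + _); apply: eq_card => A; rewrite !inE 1?andbC.
congr (_ + _).
  apply: eq_card => A; rewrite !inE; case vA: (v \in A) => /=.
    by rewrite andbF; case AV: (A \subset V) => //; have := subsetP AV _ vA; rewrite (negPf vV).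
  by rewrite andbT -subDset (setDidPl _) // disjoint_sym disjoints1 vA.
case: j @X => [|j] X /=.
  apply: eq_card0 => A; rewrite !inE cards_eq0.
  by case: eqP => [->|]; rewrite ?inE ?andbF.
rewrite -(@card_in_imset _ _ (fun A => v |: A)
  [set A : {set T} | [&& A \subset V, #|A| == j & D (v |: A)]]).
  apply: eq_card => A; rewrite !inE; apply/idP/imsetP.
    move=> /andP[/and3P[AV cA DA] vA]; exists (A :\ v); last by rewrite setD1K.
    by rewrite inE setD1K // DA subDset AV /= -eqSS -(eqP cA) (cardsD1 v A) vA add1n eqxx.
  case=> B; rewrite inE => /and3P[BV cB DB] ->.
  have vB : v \notin B by apply: contra vV; apply: subsetP.
  by rewrite setU11 DB cardsU1 vB (eqP cB) /= eqxx andbT setUS.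
move=> A B; rewrite !inE => /and3P[AV _ _] /and3P[BV _ _] e.
have vA : v \notin A by apply: contra vV; apply: subsetP.
have vB : v \notin B by apply: contra vV; apply: subsetP.
by rewrite -(setU1K vA) e setU1K.
Qed.

(** Induction on the vertices: the deletion and the link of [v] satisfy the claim on one vertex
    fewer, and [kk_seq_merge] puts them together. *)
Theorem kruskal_katona (T : finType) (D : pred {set T}) (V : {set T}) :
  (forall A B : {set T}, A \subset B -> D B -> D A) ->
  kk_seq #|V| (face_number D V).
Proof.
move: {2}#|V| (erefl #|V|) => n; elim: n V D => [|n IHn] V D cV downD.
  have V0 : V = set0 by apply/eqP; rewrite -cards_eq0 cV.
  rewrite V0 cards0; split=> [|k].
    rewrite -(cards1 (set0 : {set T})) subset_leq_card //.
    by apply/subsetP => A; rewrite !inE subset0 => /andP[].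
  rewrite leqn0 cards_eq0 -subset0; apply/subsetP => A.
  by rewrite !inE subset0 => /andP[/eqP -> /andP[]]; rewrite cards0.
have /card_gt0P[v vV] : 0 < #|V| by rewrite cV.
have cW : #|V :\ v| = n by apply/eqP; rewrite -eqSS -cV (cardsD1 v V) vV.
have e j := @face_number_setU1 _ D v (V :\ v) j (negbT (setD11 _ _)).
rewrite -(setD1K vV) cardsU1 setD11 cW add1n.
have h1 := IHn _ D cW downD.
have h2 := IHn _ (fun A => D (v |: A)) cW (fun A B AB => downD _ _ (setUS _ AB)).
rewrite cW in h1 h2.
have [] := kk_seq_merge h1 h2.
  move=> j; rewrite /face_number subset_leq_card //; apply/subsetP => A.
  by rewrite !inE => /and3P[-> -> /(downD A) ->] //; apply: subsetUr.
by move=> s0 s; split=> [|k]; rewrite !e.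
Qed.

(** * Verified lower bounds for upper shadows *)

Local Delimit Scope Z_scope with BZ.

(** The multiplicative recurrence in binary integers makes the finite check computable; each
    division is exact by [mul_bin_left]. *)
Fixpoint binZ (n k : nat) : Z :=
  if k is k'.+1 then (binZ n k' * Z.of_nat (n - k') / Z.of_nat k)%BZ else 1%BZ.

Lemma binZE n k : binZ n k = Z.of_nat 'C(n, k).
Proof.
elim: k => [|k IHk]; first by rewrite bin0.
rewrite [LHS]/= IHk; have := mul_bin_left n k => h.
by apply/esym/Z.div_unique_exact; lia.
Qed.

Fixpoint kkZ (n k : nat) (m : Z) : Z :=
  if n is n'.+1 then
    if k is k'.+1 then
      let b := binZ n' k in
      if (m <=? b)%BZ then kkZ n' k m else (binZ n' k.+1 + kkZ n' k' (m - b))%BZ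
    else if (m =? 0)%BZ then 0%BZ else Z.of_nat n
  else 0%BZ.

Lemma kkZE n k m : kkZ n k (Z.of_nat m) = Z.of_nat (kk n k m).
Proof.
elim: n k m => [|n IHn] [|k] m //.
  by rewrite /= ; case: m.
rewrite /kkZ -/kkZ /kk -/kk !binZE; case: Z.leb_spec => h1; case: leqP => h2; [|lia..|].
  exact: IHn.
have -> : (Z.of_nat m - Z.of_nat 'C(n, k.+1) = Z.of_nat (m - 'C(n, k.+1)))%BZ by lia.
by rewrite IHn; lia.
Qed.

(* A triple (p, r, d) stands for the lower bound (p m + r) / d on the size of
   the upper shadow of m = 'C(n, k) - a missing sets. *)
Definition below (n k : nat) (a g : Z) (l : Z * Z * Z) : bool :=
  let: (p, r, d) := l in
  [&& (0 <=? p)%BZ, (0 <=? d)%BZ &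
   (p * (binZ n k - a) + r <=? d * (binZ n k.+1 - g))%BZ].

(* Since kk is monotone, one evaluation at hi settles the whole interval
   [nx, hi]. *)
Fixpoint check (fuel n k : nat) (L : seq (Z * Z * Z)) (lo hi : Z) : bool :=
  (hi <? lo)%BZ || if fuel is f.+1 then
    let g := kkZ n k hi in
    let nx := foldr (fun l x => let: (p, r, d) := l in
       Z.min x (binZ n k - (d * (binZ n k.+1 - g) - r) / p)) hi L in
    has (below n k nx g) L && check f n k L lo (nx - 1)
  else false.

(** As [p] and [d] are nonnegative, an inequality that holds at [nx] with [g] survives raising [a]
    and lowering [g]. Correctness rests on the test at [nx], not on the formula proposing [nx]. *)
Lemma checkP fuel n k L lo hi a : check fuel n k L lo hi ->
  (lo <= Z.of_nat a <= hi)%BZ -> has (below n k (Z.of_nat a) (Z.of_nat (kk n k a))) L.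
Proof.
elim: fuel hi => [|f IHf] hi; rewrite /check -/check.
  by rewrite orbF => /Z.ltb_lt ? ?; exfalso; lia.
case/orP => [/Z.ltb_lt ? ?|]; first by exfalso; lia.
set g := kkZ _ _ _; set nx := foldr _ _ _ => /andP[hnx rest] hi_a.
case: (Z.leb_spec nx (Z.of_nat a)) => h; last by apply: IHf rest _; lia.
move: hnx; apply: sub_has => -[[p r] d]; rewrite /below => /and3P[p0 d0 /Z.leb_le le].
rewrite p0 d0; apply/Z.leb_le; move: p0 d0 => /Z.leb_le p0 /Z.leb_le d0.
have gE : g = Z.of_nat (kk n k (Z.to_nat hi)) by rewrite -kkZE Z2Nat.id //; lia.
have gle : (Z.of_nat (kk n k a) <= g)%BZ.
  by rewrite gE; apply: inj_le; apply/leP/kk_mono; lia.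
apply: Z.le_trans (Z.le_trans _ _ _ _ le) _.
  by apply: Zplus_le_compat_r; apply: Z.mul_le_mono_nonneg_l; lia.
by apply: Z.mul_le_mono_nonneg_l; lia.
Qed.

(* The beta^8_j of the full simplex on N + 8 vertices. *)
Definition hvec N j := binZ (N + j - 1) j.

(* Lower bounds for d_(k+1) in terms of d_k: by linear programming, the extreme
   cases are those where a single beta^8_i with 2 <= i <= k is nonzero. *)
Definition bounds (N k : nat) : seq (Z * Z * Z) :=
  (match k return seq (Z * Z * Z) with
  | 2%N => [:: (5, 0, 1)]
  | 3%N => [:: (4, 0, 1); (7, 5 * hvec N 3, 3)]
  | 4%N => [:: (3, 0, 1); (9, 6 * hvec N 4, 5); (19, 26 * hvec N 4 + 40 * hvec N 3, 15)]
  | 5%N => [:: (2, 0, 1); (5, 3 * hvec N 5, 4); (9, 11 * hvec N 5 + 14 * hvec N 4, 10);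
             (7, 13 * hvec N 5 + 22 * hvec N 4 + 20 * hvec N 3, 10)]
  | 6%N => [:: (1, 0, 1); (2, hvec N 6, 3); (1, hvec N 6 + hvec N 5, 2)]
  | _ => [::]
  end)%BZ.

(** The start of the range to be checked. Inverting the beta's gives a_k as the sum of 'C(8 - j, k -
    j) beta^8_j(a); the terms j = 0, 1 are kept, where beta^8_0 = 1 and beta^8_1 = N. *)
Definition first_face N k := (binZ 8 k + Z.of_nat N * binZ 7 k.-1)%BZ.

Local Notation checks N k lo hi := (check 40 (N + 8) k (bounds N k) lo hi).

Lemma checks_main : all (fun N => all (fun k =>
   [|| (N == 3) && (k == 3), (N == 4) && (k == 4)
    | checks N k (first_face N k) (binZ (N + 8) k)]) (iota 2 5)) (iota 1 10).
Proof. by vm_compute. Qed.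

(** The omitted value 120 is d_3 = 165 - 120 = 45. *)
Lemma checks_3 : checks 3 3 (first_face 3 3) 119 && checks 3 3 121 (binZ (3 + 8) 3).
Proof. by vm_compute. Qed.

(** The omitted values 450 and 451 are d_4 = 495 - 450 = 45 and d_4 = 44. *)
Lemma checks_4 : checks 4 4 (first_face 4 4) 449 && checks 4 4 452 (binZ (4 + 8) 4).
Proof. by vm_compute. Qed.

Lemma bounds_hold N k a : 1 <= N <= 10 -> 2 <= k <= 6 ->
  'C(8, k) + N * 'C(7, k.-1) <= a <= 'C(N + 8, k) ->
  [\/ has (below (N + 8) k (Z.of_nat a) (Z.of_nat (kk (N + 8) k a))) (bounds N k),
      [/\ N = 3, k = 3 & a = 120] | [/\ N = 4, k = 4 & a = 450 \/ a = 451]].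
Proof.
move=> hN hk ha.
have hZ : (first_face N k <= Z.of_nat a <= binZ (N + 8) k)%BZ.
  by rewrite /first_face !binZE; lia.
have /allP/(_ N) := checks_main; rewrite mem_iota => /(_ ltac:(lia)).
move=> /allP/(_ k); rewrite mem_iota => /(_ ltac:(lia)) /or3P[]; last first.
- by move=> h; constructor 1; exact: (checkP h hZ).
- case/andP=> /eqP eN /eqP ek; subst N k; case/andP: checks_4 => h1 h2.
  case: (Z.leb_spec (Z.of_nat a) 449) => h; first by constructor 1; apply: (checkP h1); lia.
  case: (Z.leb_spec 452 (Z.of_nat a)) => h'; first by constructor 1; apply: (checkP h2); lia.
  by constructor 3; clear - h h'; split=> //; lia.
- case/andP=> /eqP eN /eqP ek; subst N k; case/andP: checks_3 => h1 h2.
  case: (Z.leb_spec (Z.of_nat a) 119) => h; first by constructor 1; apply: (checkP h1); lia.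
  case: (Z.leb_spec 121 (Z.of_nat a)) => h'; first by constructor 1; apply: (checkP h2); lia.
  by constructor 2; clear - h h'; split=> //; lia.
Qed.

(** * The numbers beta *)

Import Order.TTheory GRing.Theory Num.Theory.
Local Open Scope ring_scope.

Definition beta_of (f : nat -> int) (q k : nat) : int :=
  \sum_(j < k.+1) (-1) ^+ (k - j) * ('C(q - j, k - j))%:Z * f j.

Definition cone (f : nat -> int) (j : nat) : int :=
  f j + (if j is i.+1 then f i else 0).

Lemma eq_beta_of f g q k : (forall j, (j <= k)%N -> f j = g j) ->
  beta_of f q k = beta_of g q k.
Proof. by move=> fg; apply: eq_bigr => j _; rewrite fg // -ltnS. Qed.

Lemma beta_ofB f g q k :
  beta_of (fun j => f j - g j) q k = beta_of f q k - beta_of g q k.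
Proof. by rewrite /beta_of -sumrB; apply: eq_bigr => j _; rewrite mulrBr. Qed.

(** For [j <= q] the binomial ['C(q - j, q.+1 - j)] vanishes. This settles the boundary index that
    coning introduces. *)
Lemma beta_of_top f q : beta_of f q q.+1 = f q.+1.
Proof.
rewrite /beta_of big_ord_recr /= subnn bin0 expr0 !mul1r big1 ?add0r // => j _.
by rewrite bin_small ?mulr0 ?mul0r //; have := ltn_ord j; lia.
Qed.

(** Each [f j] occurs in two consecutive terms, with opposite signs; Pascal's rule turns the
    difference of their binomials into ['C(q - j, k - j)]. *)
Lemma beta_of_cone f q k : (k <= q.+1)%N -> beta_of (cone f) q.+1 k = beta_of f q k.
Proof.
move=> kq; rewrite /beta_of /cone.
under eq_bigr do rewrite mulrDr.
rewrite big_split /= [X in _ + X]big_ord_recl mulr0 add0r [X in X + _]big_ord_recr.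
rewrite [RHS]big_ord_recr /= addrAC -big_split /= subnn !bin0; congr (_ + _).
apply: eq_bigr => j _; rewrite /bump /= add1n subSS.
have jk := ltn_ord j; have -> : (q.+1 - j = (q - j).+1)%N by lia.
have -> : (k - j = (k - j.+1).+1)%N by lia.
by rewrite binS PoszD exprS; ring.
Qed.

(** A simplex is a cone over a simplex with one vertex fewer, so cones are peeled off until [p = 0]
    or [k] reaches the boundary case. *)
Lemma beta_of_bin n p k : (k <= p <= n)%N ->
  beta_of (fun j => ('C(n, j))%:Z) p k = ('C(n - p + k - 1, k))%:Z.
Proof.
elim: p n k => [|p IHp] n k.
  by rewrite leqn0 => /andP[/eqP -> _]; rewrite /beta_of big_ord1 !bin0 expr0 !mul1r.
case: n => [|n] /andP[kp pn] //.
rewrite (@eq_beta_of _ (cone (fun j => ('C(n, j))%:Z))).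
  rewrite beta_of_cone // subSS; move: kp; rewrite leq_eqVlt => /orP[/eqP ->|kp].
    by rewrite beta_of_top; congr (('C(_, _))%:Z); lia.
  by rewrite IHp // -ltnS kp.
by case=> [|j] _; rewrite /cone ?bin0 ?addr0 // binS PoszD.
Qed.

Ltac compute_signed_binomials :=
  repeat match goal with |- context [@GRing.mul _ (?x ^+ ?n) (Posz (binomial ?a ?b))] =>
    let t := constr:(@GRing.mul int (x ^+ n) (Posz (binomial a b))) in
    let v := eval vm_compute in t in
    rewrite (_ : t = v); last by vm_compute
  end.

Lemma beta8E (f : nat -> int) :
  (beta_of f 8%N 2 = f 2%N - 7 * f 1%N + 28 * f 0%N) *
  (beta_of f 8%N 3 = f 3%N - 6 * f 2%N + 21 * f 1%N - 56 * f 0%N) *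
  (beta_of f 8%N 4 = f 4%N - 5 * f 3%N + 15 * f 2%N - 35 * f 1%N + 70 * f 0%N) *
  (beta_of f 8%N 5 = f 5%N - 4 * f 4%N + 10 * f 3%N - 20 * f 2%N + 35 * f 1%N - 56 * f 0%N) *
  (beta_of f 8%N 6 = f 6%N - 3 * f 5%N + 6 * f 4%N - 10 * f 3%N + 15 * f 2%N
     - 21 * f 1%N + 28 * f 0%N).
Proof.
by rewrite /beta_of !big_ord_recr !big_ord0 /=; compute_signed_binomials;
  do ?apply: pair; lia.
Qed.

Lemma beta7E (f : nat -> int) : f 0%N = 0 -> f 1%N = 0 ->
  (beta_of f 7%N 0 = 0) * (beta_of f 7%N 1 = 0) * (beta_of f 7%N 2 = f 2%N) *
  (beta_of f 7%N 3 = f 3%N - 5 * f 2%N) *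
  (beta_of f 7%N 4 = f 4%N - 4 * f 3%N + 10 * f 2%N) *
  (beta_of f 7%N 5 = f 5%N - 3 * f 4%N + 6 * f 3%N - 10 * f 2%N) *
  (beta_of f 7%N 6 = f 6%N - 2 * f 5%N + 3 * f 4%N - 4 * f 3%N + 5 * f 2%N) *
  (beta_of f 7%N 7 = f 7%N - f 6%N + f 5%N - f 4%N + f 3%N - f 2%N).
Proof.
move=> f0 f1.
by rewrite /beta_of !big_ord_recr !big_ord0 /= f0 f1;
  compute_signed_binomials; do ?apply: pair; lia.
Qed.

Lemma belowP n k a g p r d : below n k a g (p, r, d) ->
  (p * (Z.of_nat 'C(n, k) - a) + r <= d * (Z.of_nat 'C(n, k.+1) - g))%BZ.
Proof. by case/and3P => _ _ /Z.leb_le; rewrite !binZE. Qed.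

Definition missing (n : nat) (a : nat -> nat) (j : nat) : int := ('C(n, j))%:Z - (a j)%:Z.

(** * The case q = 8 with every vertex a face *)

Section EightDimensional.
Variables (N : nat) (a : nat -> nat).
Hypothesis a_kk : kk_seq (N + 8) a.
Hypothesis a0 : a 0%N = 1%N.
Hypothesis a1 : a 1%N = (N + 8)%N.
Hypothesis a_beta : forall k, (k <= 8)%N -> 0 <= beta_of (fun j => (a j)%:Z) 8 k.

Let d := missing (N + 8) a.

Let d_ge0 j : 0 <= d j.
Proof. by have := kk_seq_bound a_kk j; rewrite /d /missing; lia. Qed.

Let d0 : d 0%N = 0. Proof. by rewrite /d /missing a0 bin0. Qed.
Let d1 : d 1%N = 0. Proof. by rewrite /d /missing a1 bin1; lia. Qed.

Let d_beta k : (k <= 8)%N -> beta_of d 8 k <= ('C(N + k - 1, k))%:Z.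
Proof.
move=> k8; have := a_beta k8; rewrite /d /missing beta_ofB beta_of_bin; last lia.
by rewrite addnK; lia.
Qed.

Let d_next k : ('C(N + 8, k.+1))%:Z - (kk (N + 8) k (a k))%:Z <= d k.+1.
Proof. by case: a_kk => _ /(_ k); rewrite /d /missing; lia. Qed.

Let beta_upper :
  [/\ d 2%N <= ('C(N + 1, 2))%:Z,
     d 3%N - 6 * d 2%N <= ('C(N + 2, 3))%:Z,
     d 4%N - 5 * d 3%N + 15 * d 2%N <= ('C(N + 3, 4))%:Z,
     d 5%N - 4 * d 4%N + 10 * d 3%N - 20 * d 2%N <= ('C(N + 4, 5))%:Z
   & d 6%N - 3 * d 5%N + 6 * d 4%N - 10 * d 3%N + 15 * d 2%N <= ('C(N + 5, 6))%:Z].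
Proof.
have E := beta8E d; rewrite d0 d1 in E.
have e k m : (N + k.+1 - 1 = m)%N -> (N + k = m)%N by lia.
split; [have := @d_beta 2 isT|have := @d_beta 3 isT|have := @d_beta 4 isT
       |have := @d_beta 5 isT|have := @d_beta 6 isT]; rewrite !E -(e _ _ (erefl _)); lia.
Qed.

Let first_face_lower : all (fun k => 'C(8, k) + N * 'C(7, k.-1) <= a k)%N (iota 2 5).
Proof.
have E := beta8E (fun j => (a j)%:Z); rewrite a0 a1 in E.
have := @a_beta 2 isT; have := @a_beta 3 isT; have := @a_beta 4 isT.
have := @a_beta 5 isT; have := @a_beta 6 isT; rewrite !E => {E}.
rewrite /= /binomial /= => h2 h3 h4 h5 h6.
by do !(apply/andP; split=> //); lia.
Qed.

Let in_range k : (2 <= k <= 6)%N -> ('C(8, k) + N * 'C(7, k.-1) <= a k <= 'C(N + 8, k))%N.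
Proof.
move=> hk; rewrite (kk_seq_bound a_kk) andbT.
by apply: (allP first_face_lower); rewrite mem_iota; lia.
Qed.

Let small_bounds : (1 <= N <= 10)%N ->
  [/\ 5 * d 2%N <= d 3%N,
   [\/ 4 * d 3%N <= d 4%N, 7 * d 3%N + 5 * ('C(N + 2, 3))%:Z <= 3 * d 4%N
     | N = 3%N /\ a 3%N = 120%N],
   [\/ 3 * d 4%N <= d 5%N, 9 * d 4%N + 6 * ('C(N + 3, 4))%:Z <= 5 * d 5%N,
       19 * d 4%N + 26 * ('C(N + 3, 4))%:Z + 40 * ('C(N + 2, 3))%:Z <= 15 * d 5%N
     | N = 4%N /\ (a 4%N = 450%N \/ a 4%N = 451%N)],
   [\/ 2 * d 5%N <= d 6%N, 5 * d 5%N + 3 * ('C(N + 4, 5))%:Z <= 4 * d 6%N,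
       9 * d 5%N + 11 * ('C(N + 4, 5))%:Z + 14 * ('C(N + 3, 4))%:Z <= 10 * d 6%N
     | 7 * d 5%N + 13 * ('C(N + 4, 5))%:Z + 22 * ('C(N + 3, 4))%:Z
         + 20 * ('C(N + 2, 3))%:Z <= 10 * d 6%N]
 & [\/ d 6%N <= d 7%N, 2 * d 6%N + ('C(N + 5, 6))%:Z <= 3 * d 7%N
     | d 6%N + ('C(N + 5, 6))%:Z + ('C(N + 4, 5))%:Z <= 2 * d 7%N]].
Proof.
move=> hN.
have e k : (N + k.+1 - 1 = N + k)%N by lia.
split.
- have := bounds_hold hN (_ : 2 <= 2 <= 6)%N (in_range _).
  case=> // [|[]//|[]//]; cbn [has bounds]; rewrite orbF => /belowP.
  have := d_next 2; rewrite /d /missing; lia.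
- have := bounds_hold hN (_ : 2 <= 3 <= 6)%N (in_range _).
  case=> // [|[? _ ?]|[]//]; last by constructor 3.
  cbn [has bounds]; rewrite orbF /hvec !binZE !e => /orP[] /belowP.
    by constructor 1; have := d_next 3; rewrite /d /missing; lia.
  by constructor 2; have := d_next 3; rewrite /d /missing; lia.
- have := bounds_hold hN (_ : 2 <= 4 <= 6)%N (in_range _).
  case=> // [|[]//|[? _ ?]]; last by constructor 4.
  cbn [has bounds]; rewrite orbF /hvec !binZE !e => /or3P[] /belowP.
  + by constructor 1; have := d_next 4; rewrite /d /missing; lia.
  + by constructor 2; have := d_next 4; rewrite /d /missing; lia.
  + by constructor 3; have := d_next 4; rewrite /d /missing; lia.
- have := bounds_hold hN (_ : 2 <= 5 <= 6)%N (in_range _).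
  case=> // [|[]//|[]//].
  cbn [has bounds]; rewrite orbF /hvec !binZE !e => /or4P[] /belowP.
  + by constructor 1; have := d_next 5; rewrite /d /missing; lia.
  + by constructor 2; have := d_next 5; rewrite /d /missing; lia.
  + by constructor 3; have := d_next 5; rewrite /d /missing; lia.
  + by constructor 4; have := d_next 5; rewrite /d /missing; lia.
- have := bounds_hold hN (_ : 2 <= 6 <= 6)%N (in_range _).
  case=> // [|[]//|[]//].
  cbn [has bounds]; rewrite orbF /hvec !binZE !e => /or3P[] /belowP.
  + by constructor 1; have := d_next 6; rewrite /d /missing; lia.
  + by constructor 2; have := d_next 6; rewrite /d /missing; lia.
  + by constructor 3; have := d_next 6; rewrite /d /missing; lia.
Qed.

(** The full simplex attains equality in [kk_lym], so passing to the missing sets reverses the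
    inequality. *)
Let d_lym k : ((N + 8 - k)%N)%:Z * d k <= k.+1%:Z * d k.+1.
Proof.
have := kk_lym (kk_seq_bound a_kk k); have := mul_bin_left (N + 8) k.
case: a_kk => _ /(_ k); rewrite /d /missing; nia.
Qed.

Let d4_exception : N = 3%N -> a 3%N = 120%N -> d 3%N = 45 /\ 120 <= d 4%N.
Proof.
move=> N3 a3; have : Z.of_nat (kk (3 + 8) 3 120) = 210%BZ by rewrite -kkZE; vm_compute.
have e3 : 'C(3 + 8, 3) = 165%N by []. have e4 : 'C(3 + 8, 4) = 330%N by [].
by have := d_next 3; rewrite /d /missing a3 N3 e3 e4; lia.
Qed.

(* For d_2 = 0, d_3 = 2 and d_4 = 45, everything but beta^8_6 >= 0 would allow
   d_5 = 120 < 3 d_4 - 6 d_3. *)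
Let d5_exception : N = 4%N -> a 4%N = 450%N \/ a 4%N = 451%N ->
  [/\ 44 <= d 4%N <= 45, 120 <= d 5%N & d 5%N <= 122 -> 210 <= d 6%N].
Proof.
move=> N4 a4.
have v4 : Z.of_nat (kk (4 + 8) 4 451) = 672%BZ by rewrite -kkZE; vm_compute.
have v5 : Z.of_nat (kk (4 + 8) 5 672) = 714%BZ by rewrite -kkZE; vm_compute.
have e4 : 'C(4 + 8, 4) = 495%N by []. have e5 : 'C(4 + 8, 5) = 792%N by [].
have e6 : 'C(4 + 8, 6) = 924%N by [].
have a5 : (a 5%N <= 672)%N.
  have : (kk (4 + 8) 4 (a 4%N) <= kk (4 + 8) 4 451)%N by apply: kk_mono; lia.
  by case: a_kk => _ /(_ 4%N); rewrite N4; lia.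
have := kk_mono (4 + 8) 5 a5.
by case: a_kk => _ /(_ 5%N); rewrite /d /missing N4 e4 e5 e6; split; lia.
Qed.

Lemma beta_missing_ge0 k : (k <= 7)%N -> 0 <= beta_of d 7 k.
Proof.
have E := beta7E d0 d1; have [b2 b3 b4 b5 b6] := beta_upper.
have n2 := d_ge0 2; have n3 := d_ge0 3; have n4 := d_ge0 4.
suff H : [/\ 5 * d 2%N <= d 3%N, 4 * d 3%N - 10 * d 2%N <= d 4%N,
    3 * d 4%N - 6 * d 3%N + 10 * d 2%N <= d 5%N,
    2 * d 5%N - 3 * d 4%N + 4 * d 3%N - 5 * d 2%N <= d 6%N
  & d 6%N - d 5%N + d 4%N - d 3%N + d 2%N <= d 7%N].
  case: H => h3 h4 h5 h6 h7.
  by case: k => [|[|[|[|[|[|[|[|//]]]]]]]] _; rewrite E //; lia.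
case: (ltnP 10 N) => [N_large|N_le].
  have := d_lym 2; have := d_lym 3; have := d_lym 4; have := d_lym 5; have := d_lym 6.
  (* Each coefficient is its value at N = 11 plus a nonnegative rest. At N = 11 the ratios d_4 / d_3
     >= 16/4 and d_5 / d_4 >= 15/5 are just large enough. *)
  have -> : ((N + 8 - 2)%N = (N - 11) + 17)%N by lia.
  have -> : ((N + 8 - 3)%N = (N - 11) + 16)%N by lia.
  have -> : ((N + 8 - 4)%N = (N - 11) + 15)%N by lia.
  have -> : ((N + 8 - 5)%N = (N - 11) + 14)%N by lia.
  have -> : ((N + 8 - 6)%N = (N - 11) + 13)%N by lia.
  have n5 := d_ge0 5; have n6 := d_ge0 6.
  move=> l6 l5 l4 l3 l2.
  have {}l2 : 17 * d 2%N <= 3 * d 3%N by nia.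
  have {}l3 : 16 * d 3%N <= 4 * d 4%N by nia.
  have {}l4 : 15 * d 4%N <= 5 * d 5%N by nia.
  have {}l5 : 14 * d 5%N <= 6 * d 6%N by nia.
  have {}l6 : 13 * d 6%N <= 7 * d 7%N by nia.
  by split; lia.
case: (posnP N) => [N0|N_gt0].
  have n5 := d_ge0 5; have n6 := d_ge0 6; have n7 := d_ge0 7.
  (* For N = 0 the binomials vanish, which forces d_2, ..., d_6 to be 0 in turn. *)
  move: b2 b3 b4 b5 b6; rewrite N0 !bin_small // => b2 b3 b4 b5 b6.
  by split; lia.
have [h3 h4 h5 h6 h7] := small_bounds (introT andP (conj N_gt0 N_le)).
(* The second alternative is combined with [b3] through 3 (4 d_3 - 10 d_2) = 7 d_3 + 5 (d_3 - 6
   d_2); the later alternatives are treated likewise. *)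
have {}h4 : 4 * d 3%N - 10 * d 2%N <= d 4%N.
  case: h4 => [|| [N3 a3]]; [lia|lia|].
  (* From 45 - 6 d_2 <= 10 integrality gives d_2 >= 6, hence 4 d_3 - 10 d_2 <= 120 <= d_4. *)
  have [] := d4_exception N3 a3; move: b3; rewrite N3.
  by have -> : 'C(3 + 2, 3) = 10%N by []; lia.
have {}h5 : 3 * d 4%N - 6 * d 3%N + 10 * d 2%N <= d 5%N.
  case: h5 => [|||[N4 a4]]; [lia|lia|lia|].
  (* By [b4] and integrality d_3 >= 3 d_2 + 2, so the left side exceeds 120 only for d_2 = 0, d_3 =
     2, d_4 = 45, where it is 123. There d_5 <= 122 would give d_6 <= 200 by [b6], against d_6 >=
     210. *)
  have [] := d5_exception N4 a4; move: b3 b4 b6; rewrite N4.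
  have -> : 'C(4 + 2, 3) = 20%N by []. have -> : 'C(4 + 3, 4) = 35%N by [].
  have -> : 'C(4 + 5, 6) = 84%N by []. lia.
have {}h6 : 2 * d 5%N - 3 * d 4%N + 4 * d 3%N - 5 * d 2%N <= d 6%N.
  by case: h6; lia.
have {}h7 : d 6%N - d 5%N + d 4%N - d 3%N + d 2%N <= d 7%N.
  by case: h7; lia.
by [].
Qed.

End EightDimensional.

(** * From depth at most 8 to depth 8, and to ideals *)

Lemma beta_missing_spanning m q n (a : nat -> nat) : (q + m = 8)%N -> (0 < q <= n)%N ->
  kk_seq n a -> a 0%N = 1%N -> a 1%N = n ->
  (forall k, (k <= q)%N -> 0 <= beta_of (fun j => (a j)%:Z) q k) ->
  forall k, (k < q)%N -> 0 <= beta_of (missing n a) q.-1 k.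
Proof.
elim: m q n a => [|m IHm] q n a qm /andP[q_gt0 qn] a_kk a0 a1 a_ge0 k kq.
  move: qm qn a_ge0 kq; rewrite addn0 => -> n8 a_ge0 k8.
  have nE : ((n - 8) + 8 = n)%N by lia.
  by rewrite -nE; apply: beta_missing_ge0; rewrite ?nE.
pose b j := (a j + shift a j)%N.
have bE : (fun j => (b j)%:Z) =1 cone (fun j => (a j)%:Z) by case.
(* The simplex is coned along with the complex, so its missing sets are coned too. *)
have missE : missing n.+1 b =1 cone (missing n a).
  by case=> [|j]; rewrite /missing /cone /b /shift ?bin0 ?binS; lia.
case: q q_gt0 qm qn a_ge0 kq => // q _ qm qn a_ge0 kq; rewrite -pred_Sn.
rewrite -beta_of_cone ?(ltnW kq) //.
rewrite -(@eq_beta_of (missing n.+1 b)); last by move=> j _; apply: missE.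
apply: (IHm q.+2 n.+1 b); rewrite ?ltnS ?addSnnS // /b ?a1 /= ?addn0 ?a0 ?addn1 //.
- by rewrite addnS -addSn.
- exact: kk_seq_merge.
- move=> i; rewrite (@eq_beta_of _ (cone (fun j => (a j)%:Z))); last first.
    by move=> j _; apply: bE.
  (* The one new condition, at the top index [q.+2], says that [a q.+2] is nonnegative. *)
  rewrite leq_eqVlt => /orP[/eqP ->|]; last by move=> ?; rewrite beta_of_cone ?a_ge0 // ltnW.
  by rewrite beta_of_cone // beta_of_top.
- exact: ltnW.
Qed.

(** The ground set is cut down to the [a 1] vertices that are faces. Only the simplex term
    ['C(n - q.-1 + k - 1, k)] depends on [n], and it does not decrease when [n] grows. *)
Lemma beta_missing q n (a : nat -> nat) : (0 < q <= 8)%N ->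
  kk_seq n a -> a 0%N = 1%N ->
  (forall k, (k <= q)%N -> 0 <= beta_of (fun j => (a j)%:Z) q k) ->
  forall k, (k < q)%N -> 0 <= beta_of (missing n a) q.-1 k.
Proof.
move=> /andP[q_gt0 q8] a_kk a0 a_ge0 k kq.
have a1n : (a 1 <= n)%N by rewrite -(bin1 n) (kk_seq_bound a_kk).
(* This is the condition at k = 1, where beta^q_1 = a_1 - q. *)
have qa1 : (q <= a 1)%N.
  have := a_ge0 1%N q_gt0.
  rewrite /beta_of !big_ord_recr big_ord0 /= subn0 subnn a0 bin0 bin1 expr1 expr0; lia.
have a_kk' : kk_seq (a 1%N) a by apply: kk_seq_shrink a_kk _; rewrite leqnn.
have := @beta_missing_spanning (8 - q) q (a 1%N) a.
rewrite subnKC // q_gt0 => /(_ erefl qa1 a_kk' a0 erefl a_ge0 k kq).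
rewrite /missing !beta_ofB !beta_of_bin; [|lia..].
have : ('C(a 1 - q.-1 + k - 1, k) <= 'C(n - q.-1 + k - 1, k))%N.
  by apply: leq_bin2l; lia.
lia.
Qed.

(** * Squarefree monomials as sets of variables *)

Section SquarefreeMonomials.
Variable n : nat.

Definition mon (A : {set 'I_n}) : 'X_{1..n} := [multinom (i \in A : nat) | i < n].

Lemma mdeg_mon A : mdeg (mon A) = #|A|.
Proof.
rewrite mdegE -sum1_card [RHS]big_mkcond; apply: eq_bigr => i _.
by rewrite mnmE; case: (i \in A).
Qed.

Lemma monK (m : 'X_{1..n}) : squarefree_mon m -> mon [set i | m i == 1%N] = m.
Proof.
move=> /forallP sm; apply/mnmP => i; rewrite mnmE inE.
by have := sm i; case: (m i) => [|[|]].
Qed.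

Lemma card_squarefree (P : pred 'X_{1..n}) j :
  #|[set m : 'X_{1..n < j.+1} | [&& squarefree_mon m, mdeg m == j & P m]]|
    = #|[set A : {set 'I_n} | (#|A| == j) && P (mon A)]|.
Proof.
pose f (m : 'X_{1..n < j.+1}) := [set i | (m : 'X_{1..n}) i == 1%N].
rewrite -(@card_in_imset _ _ f); last first.
  move=> m1 m2; rewrite !inE => /andP[s1 _] /andP[s2 _] e; apply: val_inj => /=.
  by rewrite -(monK s1) -(monK s2) -/(f m1) e.
apply: eq_card => A; rewrite !inE; apply/imsetP/andP.
  case=> m; rewrite inE => /and3P[sm dm Pm] ->; rewrite /f monK // Pm.
  by rewrite -mdeg_mon monK.
case=> cA PA; have lt : (mdeg (mon A) < j.+1)%N by rewrite mdeg_mon (eqP cA).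
exists (BMultinom lt); last by apply/setP => i; rewrite inE /= mnmE; case: (i \in A).
rewrite inE /= mdeg_mon cA PA !andbT; apply/forallP => i.
by rewrite mnmE leq_b1.
Qed.

End SquarefreeMonomials.

Lemma beta_ofE (K : fieldType) (n : nat) (J I : {pred {mpoly K[n]}}) q k :
  beta J I q k = beta_of (fun j => (alpha J I j)%:Z) q k.
Proof. by []. Qed.

(** * The simplicial complex of a squarefree monomial ideal *)

Section Ideal.
Variables (K : fieldType) (n : nat) (I : {pred {mpoly K[n]}}).
Hypothesis I_sqfree : squarefree_monomial_ideal I.
Hypothesis I_proper : ~ (I =i unit_ideal K n).

Let nonface (A : {set 'I_n}) : bool := ('X_[mon A] : {mpoly K[n]}) \in I.

Lemma ideal_mulr (p r : {mpoly K[n]}) : p \in I -> p * r \in I.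
Proof.
case: I_sqfree => G _ IG /IG[c ->]; apply/IG; exists (fun m => c m * r).
by rewrite mulr_suml; apply: eq_bigr => m _; rewrite mulrAC.
Qed.

Lemma nonface_sub (A B : {set 'I_n}) : A \subset B -> nonface A -> nonface B.
Proof.
move=> /subsetP AB; rewrite /nonface.
have -> : mon B = (mon A + mon (B :\: A))%MM.
  apply/mnmP => i; rewrite mnmDE !mnmE inE.
  by case: (boolP (i \in A)) => [/AB ->|].
by rewrite mpolyXD => /ideal_mulr.
Qed.

Let a := face_number (predC nonface) [set: 'I_n].

Lemma alpha_quotient j : alpha (unit_ideal K n) I j = a j.
Proof.
rewrite /alpha /a /face_number.
rewrite (card_squarefree (fun m => ('X_[m] : {mpoly K[n]}) \notin I)).
by apply: eq_card => A; rewrite !inE subsetT.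
Qed.

Lemma alpha_ideal j : (alpha I (zero_ideal K n) j)%:Z = missing n a j.
Proof.
rewrite /alpha /missing.
have -> : #|[set m : 'X_{1..n < j.+1} | [&& squarefree_mon m, mdeg m == j,
    ('X_[m] : {mpoly K[n]}) \in I & ('X_[m] : {mpoly K[n]}) \notin zero_ideal K n]]|
    = #|[set A : {set 'I_n} | (#|A| == j) && nonface A]|.
  apply: etrans (card_squarefree (fun m => ('X_[m] : {mpoly K[n]}) \in I) j).
  apply: eq_card => m; rewrite !inE.
  suff -> : ('X_[m] : {mpoly K[n]}) != 0 by rewrite andbT.
  by rewrite -msupp_eq0 msuppX.
have := cardsID [set A | nonface A] [set A : {set 'I_n} | #|A| == j].
rewrite card_draws card_ord => <-; rewrite PoszD.
rewrite (_ : #|_ :&: _| = #|[set A : {set 'I_n} | (#|A| == j) && nonface A]|); last first.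
  by apply: eq_card => A; rewrite !inE.
rewrite (_ : #|_ :\: _| = a j) ?addrK //.
by apply: eq_card => A; rewrite !inE subsetT andbC.
Qed.

Lemma faces_kk_seq : kk_seq n a.
Proof.
rewrite -[n in kk_seq n]card_ord -cardsT; apply: kruskal_katona => A B AB.
exact: contra (nonface_sub AB).
Qed.

Lemma empty_face : a 0%N = 1%N.
Proof.
apply/eqP; rewrite /a /face_number -(cards1 (set0 : {set 'I_n})); apply/eqP.
apply: eq_card => A; rewrite !inE subsetT cards_eq0 /=; case: eqP => //= ->.
apply/negP => I1; apply: I_proper => p; rewrite [RHS]inE -(mul1r p).
suff -> : (1 : {mpoly K[n]}) = 'X_[mon set0] by apply: ideal_mulr.
rewrite -mpolyX0; congr 'X_[_]; apply/mnmP => i; by rewrite !mnmE inE.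
Qed.

End Ideal.

Theorem theorem3p7 (K : fieldType) (n : nat) (hn : (1 <= n)%N)
  (I : {pred {mpoly K[n]}}) (hI : squarefree_monomial_ideal I)
  (hI0 : ~ (I =i zero_ideal K n)) (hI1 : ~ (I =i unit_ideal K n))
  (h8 : (hdepth (unit_ideal K n) I <= 8)%N) :
  (hdepth (unit_ideal K n) I)%:Z - 1 <= (hdepth I (zero_ideal K n))%:Z.
Proof.
case: (posnP (hdepth (unit_ideal K n) I)) h8 => [->|q_gt0] q8; first by lia.
have [q hq eq] : {q : 'I_n.+1 | [forall k : 'I_q.+1, 0 <= beta (unit_ideal K n) I q k]
    & hdepth (unit_ideal K n) I = q}.
  (* The maximum is attained because 0 is admissible: beta^0_0 is a cardinality. *)
  apply: eq_bigmax_cond; apply/card_gt0P; exists ord0.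
  by apply/forallP => k; rewrite ord1 /beta big_ord1 !bin0 expr0 !mul1r.
rewrite eq in q_gt0 q8 *.
(* It remains to see that [q.-1] is admissible for [I], whose squarefree monomials are the missing
   sets. *)
suff : (q.-1 <= hdepth I (zero_ideal K n))%N by lia.
have lt : (q.-1 < n.+1)%N by have := ltn_ord q; lia.
rewrite /hdepth; apply: (@leq_bigmax_cond _ _ (fun i : 'I_n.+1 => i : nat) (Ordinal lt)).
apply/forallP => k.
rewrite beta_ofE.
rewrite (@eq_beta_of _ (missing n (face_number _ [set: 'I_n])) _ _
  (fun j _ => alpha_ideal I j)).
apply: beta_missing; rewrite ?q_gt0 //.
- exact: faces_kk_seq.
- exact: empty_face.
- move=> i iq; have /forallP/(_ (Ordinal (iq : (i < q.+1)%N))) := hq.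
  by rewrite beta_ofE (@eq_beta_of _ _ _ _ (fun j _ => congr1 Posz (alpha_quotient I j))).
- by have := ltn_ord k; rewrite /=; lia.
Qed.
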